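(* Let $N$ be a positive integer and let $q_1,\dots,q_K$ be all the positive divisors of $N$. Then: (i) The family $\{S_{1,q_i}\}_{i=1}^K$ is a Parseval fusion frame for $\ell^2(\mathbb Z_N)$. (ii) If $N=2d$ with $d$ odd, the family $\{S_{2,q_i}\}_{i=1}^K$ is a Parseval fusion frame for $\ell^2(\mathbb Z_N)$.
   Context: $\ell^2(\mathbb Z_N)$ is the $N$-dimensional complex Hilbert space of functions on $\mathbb Z_N=\{0,1,\dots,N-1\}$ (identified with $N$-periodic functions on $\mathbb Z$), with $\langle x,y\rangle=\sum_{n=0}^{N-1}x(n)\overline{y(n)}$. For $m\in\mathbb Z$, the circular shift is $L_mx(n)=x(n-m)$. For a positive integer $q$, the $q$-th Ramanujan sum is $c_q(n)=\sum_{1\le k\le q,\,(k,q)=1}e^{2\pi i kn/q}$; it is $q$-periodic, so for $q\mid N$ it is regarded as an element of $\ell^2(\mathbb Z_N)$. $\phi$ is Euler's totient function. For divisors $p$ and $q_i$ of $N$, $S_{p,q_i}:=\operatorname{span}\{L_{pk}c_{q_i}:0\le k\le\phi(q_i)-1\}$. A family of subspaces $\{W_i\}_{i=1}^K$ of $\ell^2(\mathbb Z_N)$ with positive weights $w_i$ is a fusion frame for $\ell^2(\mathbb Z_N)$ if there are $0<A\le B<\infty$ with $A\|x\|^2\le\sum_{i=1}^Kw_i^2\|P_{W_i}x\|^2\le B\|x\|^2$ for all $x\in\ell^2(\mathbb Z_N)$, where $P_W$ is the orthogonal projection onto $W$. It is a Parseval fusion frame if $A=B=1$. When no weights are written, $w_i=1$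 for all $i$. *)

(* Defs.v *)
From mathcomp Require Import all_boot all_order all_algebra.
From mathcomp Require Import reals trigo.
From mathcomp Require Import complex.

Set Implicit Arguments.
Unset Strict Implicit.
Unset Printing Implicit Defensive.

Import Order.TTheory GRing.Theory Num.Theory.

Local Open Scope ring_scope.
Local Open Scope complex_scope.

(* l^2(Z_N) is 'rV[R[i]]_N with the inner product [dotmx] of the library, which
   is conjugate-linear in its second argument. Following [mxalgebra], a subspace
   is the row space of a matrix and linear maps act on the right. *)

Lemma sub_mod_subproof (N : nat) (i : 'I_N) (m : int) :
  (`|((i : nat)%:Z - m) %% N|%Z < N)%N.
Proof.
have N_gt0 : (0 < N)%N by case: i => j; apply: leq_ltn_trans.
have N_neq0 : N%:Z != 0 by rewrite eqz_nat -lt0n.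
by rewrite -ltz_nat gez0_abs ?modz_ge0 // ltz_pmod // ltz_nat.
Qed.

Definition sub_mod (N : nat) (i : 'I_N) (m : int) : 'I_N :=
  Ordinal (sub_mod_subproof i m).

Section RamanujanFusionFrame.
Variable R : realType.

Definition shift (N : nat) (m : int) (x : 'rV[R[i]]_N) : 'rV[R[i]]_N :=
  \row_n x 0 (sub_mod n m).

Definition expi (t : R) : R[i] := cos t +i* sin t.

Definition ramanujan_sum (q : nat) (n : int) : R[i] :=
  \sum_(1 <= k < q.+1 | coprime k q) expi (2 * pi * k%:R * n%:~R / q%:R).

Definition ramanujan_vec (N q : nat) : 'rV[R[i]]_N :=
  \row_n ramanujan_sum q (n : nat)%:Z.

Definition ramanujan_space (N p q : nat) : 'M[R[i]]_N :=
  <<\matrix_(k < totient q) shift (p * k)%N%:Z (ramanujan_vec N q)>>%MS.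

(* [dotmx x x] lies in the real subfield of R[i], so [complex.Re] loses nothing. *)
Definition sqnorm (N : nat) (x : 'rV[R[i]]_N) : R := complex.Re (dotmx x x).

Definition fusion_frame_with_bounds (N K : nat)
    (W : 'I_K -> 'M[R[i]]_N) (w : 'I_K -> R) (A B : R) : Prop :=
  [/\ forall i, 0 < w i,
      0 < A <= B &
      forall x : 'rV[R[i]]_N,
        A * sqnorm x
          <= \sum_i w i ^+ 2 * sqnorm (x *m proj_ortho (W i))
          <= B * sqnorm x].

Definition parseval_fusion_frame (N K : nat)
    (W : 'I_K -> 'M[R[i]]_N) (w : 'I_K -> R) : Prop :=
  fusion_frame_with_bounds W w 1 1.

End RamanujanFusionFrame.

(* Main.v *)
(** The characters n |-> w^(an) / sqrt N, with w = exp(2 i pi / N), form a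
    unitary basis of l^2(Z_N). The Ramanujan sum c_q is the sum of the w^(an)
    over the frequencies a of order q in Z_N, and a shift by pk multiplies
    w^(an) by the k-th power of w^(-ap). When these numbers are pairwise distinct
    for a of order q, Lagrange interpolation recovers each of the phi(q)
    characters from the phi(q) shifts of c_q, so S_{p,q} is the span of the
    characters of order q. As q runs over the divisors of N these spans split the
    unitary basis, and Parseval's identity gives both bounds. For p = 2 and
    N = 2d with d odd, 2a determines a modulo d, while the order of a determines
    the parity of a, hence a modulo N. *)

Require Import Defs.
From mathcomp Require Import all_boot all_order all_algebra.
From mathcomp Require Import reals trigo.
From mathcomp Require Import complex.
From mathcomp Require Import ring lra.

Set Implicit Arguments.
Unset Strict Implicit.
Unset Printing Implicit Defensive.

Import Order.TTheory GRing.Theory Num.Theory.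

Local Open Scope ring_scope.

(** * Unitary coordinates and Lagrange interpolation *)

Section UnitaryCoordinates.
Variable C : numClosedFieldType.

Lemma dotmx_sum_row_unitary n (F : 'M[C]_n) (x : 'rV[C]_n) :
  F \is unitarymx ->
  dotmx x x = \sum_a dotmx x (row a F) * (dotmx x (row a F))^*.
Proof.
move=> Fu; pose y := x *m (F ^t*)%sesqui.
have yE a : dotmx x (row a F) = y 0 a.
  by rewrite dotmxE /y !mxE; apply: eq_bigr => j _; rewrite !mxE.
have {1 2}-> : x = y *m F.
  by rewrite /y -invmx_unitary // mulmxKV // unitarymx_unit.
rewrite dotmxE trmx_mul map_mxM /= mulmxA mulmxtVK // mxE.
by apply: eq_bigr => a _; rewrite yE !mxE.
Qed.

(** The hypotheses make [W] the span of the rows of [F] indexed by [D]. The projection keeps the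
    coordinates in [D], because [x] minus its projection is orthogonal to [W], and has zero
    coordinates elsewhere. *)
Lemma dotmx_proj_ortho n p (F : 'M[C]_n) (W : 'M[C]_(p, n)) (D : {set 'I_n})
    (x : 'rV[C]_n) :
  F \is unitarymx ->
  (forall a, a \in D -> (row a F <= W)%MS) ->
  (forall a, a \notin D -> W *m ((row a F) ^t*)%sesqui = 0) ->
  dotmx (x *m proj_ortho W) (x *m proj_ortho W)
    = \sum_(a in D) dotmx x (row a F) * (dotmx x (row a F))^*.
Proof.
move=> Fu inW orthW; rewrite (dotmx_sum_row_unitary _ Fu) [RHS]big_mkcond /=.
apply: eq_bigr => a _.
have := proj_ortho_compl_sub W x; have := proj_ortho_sub W x.
move: (x *m proj_ortho W) => y /submxP [v yE]; rewrite orthomx1E => /eqP xyW.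
case: ifPn => [aD | /orthW aW]; last first.
  by rewrite dotmxE yE -mulmxA aW mulmx0 mxE mul0r.
suff -> : dotmx y (row a F) = dotmx x (row a F) by [].
have /submxP [u ->] := inW _ aD.
rewrite !dotmxE trmx_mul map_mxM /= !mulmxA.
have /subr0_eq <- // : x *m (W ^t*)%sesqui - y *m (W ^t*)%sesqui = 0.
by rewrite -mulmxBl.
Qed.

End UnitaryCoordinates.

(** Up to the factor [s], combining the rows of [G] with the coefficients of a polynomial of size at
    most [m] evaluates it at the nodes [z b], [b] in [D]. One that vanishes at every node except
    [z a] isolates column [a]. *)
Lemma vandermonde_delta (K : fieldType) n m (D : {set 'I_n}) (z : 'I_n -> K) (s : K)
    (G : 'M[K]_(m, n)) :
  s != 0 -> (#|D| <= m)%N -> {in D &, injective z} ->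
  (forall k b, G k b = s * (z b ^+ k *+ (b \in D))) ->
  forall a, a \in D -> ((delta_mx 0 a : 'rV[K]_n) <= G)%MS.
Proof.
move=> s0 Dm zinj GE a aD.
(* Lagrange interpolation: the coefficients of [P] combine the rows of [G]. *)
pose P := \prod_(b in D :\ a) ('X - (z b)%:P).
have sP : (size P <= m)%N.
  by rewrite /P -big_enum size_prod_XsubC -cardE; rewrite (cardsD1 a) aD in Dm.
pose v := \row_(k < m) P`_k.
have vG : v *m G = (s * P.[z a]) *: delta_mx 0 a.
  apply/rowP => b; rewrite !mxE eqxx /=.
  have -> : \sum_j v 0 j * G j b = s * P.[z b] *+ (b \in D).
    rewrite (horner_coef_wide _ sP) mulr_sumr -sumrMnl; apply: eq_bigr => k _.
    by rewrite mxE GE mulrCA mulrnAr mulrnAr.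
  have [->|ba] := eqVneq b a; first by rewrite aD mulr1.
  rewrite mulr0; case: (boolP (b \in D)) => bD; last by rewrite mulr0n.
  rewrite /P horner_prod (bigD1 b) ?inE ?ba //= hornerXsubC.
  by rewrite subrr mul0r mulr0 mul0rn.
have Pa : s * P.[z a] != 0.
  rewrite mulf_neq0 // /P horner_prod; apply/prodf_neq0 => b.
  rewrite !inE hornerXsubC subr_eq0 => /andP [ba bD].
  by apply: contraNneq ba => /zinj ->.
by rewrite -(eqmx_scale _ Pa) -vG submxMl.
Qed.

(** * Frequencies of a given order *)

(* [N %/ gcdn a N] is the order of [a] in Z_N. *)
Definition freqs (N q : nat) : {set 'I_N} := [set a : 'I_N | N %/ gcdn a N == q]%N.

(** This parametrization serves both to count the frequencies of order [q] and to reindex the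
    Ramanujan sum by them. *)
Lemma freqs_imset N q (N_gt0 : (0 < N)%N) (qN : (q %| N)%N) :
  exists f : 'I_q -> 'I_N,
    [/\ injective f, forall j, f j = (j * (N %/ q))%N :> nat
      & freqs N q = f @: [set j : 'I_q | coprime j q]].
Proof.
have q_gt0 : (0 < q)%N by apply: dvdn_gt0 qN.
have Nq_gt0 : (0 < N %/ q)%N by rewrite divn_gt0 // dvdn_leq.
have NE : (q * (N %/ q) = N)%N by rewrite mulnC divnK.
have lt_f (j : 'I_q) : (j * (N %/ q) < N)%N.
  by rewrite -[X in (_ < X)%N]NE ltn_pmul2r.
exists (fun j => Ordinal (lt_f j)); split => //.
  move=> i j /(congr1 val) /= /eqP; rewrite eqn_pmul2r // => /eqP.
  exact: val_inj.
apply/setP => a; rewrite inE; apply/eqP/imsetP => [aq | [j]]; last first.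
  rewrite inE => cjq ->.
  rewrite /= -[X in gcdn _ X]NE -muln_gcdl (eqP cjq) mul1n.
  by rewrite -[X in (X %/ _)%N]NE mulnK.
have g_gt0 : (0 < gcdn a N)%N by rewrite gcdn_gt0 N_gt0 orbT.
have NqE : (N %/ q = gcdn a N)%N.
  by rewrite -[X in (X %/ _)%N](divnK (dvdn_gcdr a N)) aq mulKn.
have aE : (a %/ gcdn a N * gcdn a N = a)%N by rewrite divnK // dvdn_gcdl.
have lt_a : (a %/ gcdn a N < q)%N.
  by rewrite -(ltn_pmul2r g_gt0) aE -NqE NE.
exists (Ordinal lt_a); last by apply: val_inj; rewrite /= NqE aE.
rewrite inE /= /coprime -(eqn_pmul2r g_gt0) mul1n muln_gcdl aE.
by rewrite -[X in (q * X)%N]NqE NE.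
Qed.

Lemma card_freqs N q : (0 < N)%N -> (q %| N)%N -> #|freqs N q| = totient q.
Proof.
move=> N_gt0 /(freqs_imset N_gt0) [f [f_inj _ ->]].
rewrite card_imset // totient_count_coprime big_mkord -sum1_card big_mkcond /=.
by apply: eq_bigr => j _; rewrite inE coprime_sym; case: coprime.
Qed.

(* The hypothesis [F 0 = F N] only serves [q = 1], where the left-hand side uses
   [k = 1] and the frequency is [0]. *)
Lemma sum_coprime_freqs (V : nmodType) N q (F : nat -> V) :
  (0 < N)%N -> (q %| N)%N -> F 0 = F N ->
  \sum_(1 <= k < q.+1 | coprime k q) F (k * (N %/ q))%N
    = \sum_(a in freqs N q) F a.
Proof.
move=> N_gt0 qN F0N; have q_gt0 : (0 < q)%N by apply: dvdn_gt0 qN.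
have /(freqs_imset N_gt0) [f [f_inj fE ->]] := qN.
rewrite big_imset /=; last by move=> i j _ _; apply: f_inj.
transitivity (\sum_(0 <= k < q | coprime k q) F (k * (N %/ q))%N); last first.
  by rewrite big_mkord; apply: eq_big => j; rewrite ?inE // fE.
(* The ranges differ only in [k = q] on the left and [k = 0] on the right; both have gcd [q] with
   [q]. *)
rewrite big_mkcond big_nat_recr //= [RHS]big_mkcond [RHS]big_ltn //= addrC.
congr (_ + _).
by rewrite /coprime gcd0n gcdnn mul0n mulnC divnK // F0N.
Qed.

Lemma freqs_doubling_inj N d : odd d -> N = (2 * d)%N -> forall q,
  {in freqs N q &, forall a b : 'I_N, (2 * a = 2 * b %[mod N])%N -> a = b}.
Proof.
move=> d_odd NE q a b; rewrite !inE => /eqP aq /eqP bq ab.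
have d_gt0 : (0 < d)%N by case: d d_odd {NE}.
have N_gt0 : (0 < N)%N by rewrite NE muln_gt0.
have gE : gcdn a N = gcdn b N.
  have aN : (q * gcdn a N = N)%N by rewrite -aq divnK ?dvdn_gcdr.
  have bN : (q * gcdn b N = N)%N by rewrite -bq divnK ?dvdn_gcdr.
  have q_gt0 : (0 < q)%N by move: N_gt0; rewrite -aN muln_gt0 => /andP[].
  by apply/eqP; rewrite -(eqn_pmul2l q_gt0) aN bN.
have N2 : (2 %| N)%N by rewrite NE dvdn_mulr.
(* Since [N] is even, the parity of a frequency is that of its gcd with [N]. *)
have par : a = b %[mod 2].
  rewrite !modn2; congr (nat_of_bool _); apply: negb_inj; rewrite -!dvdn2.
  by have := congr1 (dvdn 2) gE; rewrite !dvdn_gcd N2 !andbT.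
(* Chinese remainders for 2 and [d]; cancelling 2 in [ab] gives the congruence modulo [d]. *)
have /eqP : (a == b %[mod 2 * d])%N.
  rewrite chinese_remainder ?coprime2n // par eqxx /=.
  have /eqP : (2 * a = 2 * b %[mod 2 * d])%N by rewrite -NE.
  by rewrite -!muln_modr eqn_pmul2l.
by rewrite -NE !modn_small // => /val_inj.
Qed.

(** * The discrete Fourier basis *)

Section Fourier.
Variables (C : numClosedFieldType) (N : nat) (w : C).
Hypothesis w_prim : N.-primitive_root w.

Definition fourier_mx : 'M[C]_N :=
  \matrix_(a, n) ((sqrtC N%:R)^-1 * w ^+ (a * n)).

(** A root of unity has modulus 1, so its conjugate is its inverse. *)
Lemma conj_prim_root k : (w ^+ k)^* = w ^- k.
Proof.
have N_gt0 := prim_order_gt0 w_prim.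
have w1 : `|w| = 1.
  apply/eqP; rewrite -(@pexpr_eq1 _ _ N) // -normrX (prim_expr_order w_prim).
  by rewrite normr1.
have wc : w * w^* = 1 by rewrite -normCK w1 expr1n.
have w0 : w != 0 by rewrite -normr_eq0 w1 oner_eq0.
by rewrite rmorphXn /= -exprVn -[w^-1]mulr1 -wc mulKf.
Qed.

Lemma fourier_unitary : fourier_mx \is unitarymx.
Proof.
have N_gt0 := prim_order_gt0 w_prim.
have w0 : w != 0 by rewrite (prim_root_eq0 w_prim) -lt0n.
have sE : (sqrtC N%:R)^-1 * ((sqrtC N%:R)^-1)^* = N%:R^-1 :> C.
  rewrite geC0_conj ?invr_ge0 ?sqrtC_ge0 ?ler0n //.
  by rewrite -invfM -expr2 sqrtCK.
apply/unitarymxP/matrixP => a b; rewrite !mxE.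
transitivity (N%:R^-1 * \sum_(n < N) (w ^+ a / w ^+ b) ^+ n).
  rewrite mulr_sumr; apply: eq_bigr => n _; rewrite !mxE rmorphM /= mulrACA sE.
  by rewrite conj_prim_root exprMn exprVn -!exprM.
have [->|ab] := eqVneq a b.
  rewrite divff ?expf_neq0 //; under eq_bigr do rewrite expr1n.
  by rewrite sumr_const card_ord mulVf // pnatr_eq0 -lt0n.
have u1 : w ^+ a / w ^+ b - 1 != 0.
  rewrite subr_eq0; apply: contra ab => /eqP /divr1_eq /eqP.
  by rewrite (eq_prim_root_expr w_prim) !modn_small.
apply/eqP; rewrite mulf_eq0; apply/orP; right.
(* Geometric sum: multiplying by [u - 1], where [u = w ^+ a / w ^+ b], gives [u ^+ N - 1 = 0]. *)
rewrite -(mulrI_eq0 _ (mulfI u1)) -subrX1 exprMn exprVn -!exprM.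
by rewrite ![(_ * N)%N]mulnC !exprM (prim_expr_order w_prim) !expr1n divr1 subrr.
Qed.

Variables (p q m : nat) (M : 'M[C]_(m, N)).
Hypothesis mq : (#|freqs N q| <= m)%N.
Hypothesis p_inj :
  {in freqs N q &, forall a b : 'I_N, (p * a = p * b %[mod N])%N -> a = b}.
Hypothesis ME : forall k n,
  M k n = \sum_(a in freqs N q) w ^- (a * (p * k)) * w ^+ (a * n).

(** [M] stands for the matrix of shifts. It factors as a Vandermonde matrix [G] times the Fourier
    matrix: interpolation puts the characters of order [q] in its row space, and the zero columns of
    [G] make the others orthogonal to it. *)
Lemma dotmx_proj_freqs (x : 'rV[C]_N) :
  dotmx (x *m proj_ortho (genmx M)) (x *m proj_ortho (genmx M))
   = \sum_(a in freqs N q)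
       dotmx x (row a fourier_mx) * (dotmx x (row a fourier_mx))^*.
Proof.
have N_gt0 := prim_order_gt0 w_prim.
pose s : C := sqrtC N%:R.
have s0 : s != 0 by rewrite sqrtC_eq0 pnatr_eq0 -lt0n.
pose z (a : 'I_N) := w ^- (a * p).
pose G := \matrix_(k < m, a < N) (s * (z a ^+ k *+ (a \in freqs N q))).
have MG : M = G *m fourier_mx.
  apply/matrixP => k n; rewrite ME mxE big_mkcond /=; apply: eq_bigr => a _.
  rewrite !mxE; case: ifP => _; last by rewrite mulr0 mul0r.
  rewrite mulr1n mulrACA divff // mul1r /z.
  by rewrite -!exprVn -exprM mulnA.
have z_inj : {in freqs N q &, injective z}.
  move=> a b aq bq /invr_inj /eqP; rewrite (eq_prim_root_expr w_prim).
  by rewrite ![(_ * p)%N]mulnC => /eqP /p_inj; apply.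
apply: dotmx_proj_ortho; first exact: fourier_unitary.
- move=> a aq; rewrite genmxE rowE MG submxMr //.
  by apply: (vandermonde_delta s0 mq z_inj) aq => k b; rewrite mxE.
- move=> a aq; apply/orthomx1P; rewrite genmxE; apply/orthomx1P.
  have -> : ((row a fourier_mx) ^t*)%sesqui = col a (fourier_mx ^t*)%sesqui.
    by apply/matrixP => i j; rewrite !mxE.
  rewrite colE MG mulmxA mulmxtVK ?fourier_unitary // -colE.
  by apply/colP => k; rewrite !mxE (negbTE aq) mulr0.
Qed.

End Fourier.

(** * Shifted Ramanujan sums and the Parseval identity *)

Lemma sub_mod_add N (n : 'I_N) m : (sub_mod n m%:Z + m = n %[mod N])%N.
Proof.
have N_neq0 : N%:Z != 0 by case: N n => [[]|].
apply/eqP; rewrite -eqz_nat -!modz_nat PoszD /= gez0_abs ?modz_ge0 //.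
by rewrite modzDml subrK.
Qed.

Section Ramanujan.
Variable R : realType.

Lemma expiD (s t : R) : expi (s + t) = expi s * expi t.
Proof. by rewrite /expi cosD sinD; simpc; rewrite [sin s * _ + _]addrC. Qed.

Lemma expi0 : expi (0 : R) = 1.
Proof. by rewrite /expi cos0 sin0. Qed.

Lemma expiMn (t : R) n : expi (t *+ n) = expi t ^+ n.
Proof.
elim: n => [|n IHn]; first by rewrite mulr0n expi0.
by rewrite mulrS expiD IHn exprS.
Qed.

Lemma expi_neq1 (t : R) : 0 < t < 2 * pi -> expi t != 1.
Proof.
move=> /andP [t_gt0 t_lt]; apply/eqP => -[cost _].
have /sin_gt0_pi sin_gt0 : 0 < t / 2 < pi.
  by rewrite divr_gt0 //= ltr_pdivrMr // mulrC.
(* By the half-angle formula, [cos t = 1] would force [sin (t / 2) = 0]. *)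
have : cos t = 1 - sin (t / 2) ^+ 2 *+ 2.
  have {1}-> : t = (t / 2) *+ 2 by rewrite -mulr_natr divfK ?pnatr_eq0.
  rewrite cos_mulr2n cos2sin2; ring.
by rewrite cost; nra.
Qed.

Lemma expi_prim_root N : (0 < N)%N -> N.-primitive_root (expi (2 * pi / N%:R : R)).
Proof.
move=> N_gt0; have N0 : 0 < N%:R :> R by rewrite ltr0n.
have wN : expi (2 * pi / N%:R : R) ^+ N = 1.
  rewrite -expiMn -[_ *+ N]mulr_natr divfK ?gt_eqF // mulr_natl.
  by rewrite /expi cos2pi sin2pi.
have [m w_prim mN] := prim_order_exists N_gt0 wN.
have m_gt0 := prim_order_gt0 w_prim.
have : (m <= N)%N by rewrite dvdn_leq.
rewrite leq_eqVlt => /predU1P [mE | m_lt]; first by rewrite -{1}mE.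
have := prim_expr_order w_prim; rewrite -expiMn => /eqP.
(* If the order [m] were below [N], the angle of the [m]-th power would lie strictly between 0 and
   [2 * pi]. *)
apply: contraTT => _; apply: expi_neq1.
have pi2_gt0 : 0 < 2 * pi :> R by rewrite mulr_gt0 // pi_gt0.
rewrite -[_ *+ m]mulr_natr mulrAC divr_gt0 ?mulr_gt0 ?pi_gt0 ?ltr0n //=.
by rewrite ltr_pdivrMr // ltr_pM2l // ltr_nat.
Qed.

Lemma ramanujan_sum_freqs N q n : (0 < N)%N -> (q %| N)%N ->
  ramanujan_sum R q n%:Z
    = \sum_(a in freqs N q) expi (2 * pi / N%:R : R) ^+ (a * n).
Proof.
move=> N_gt0 qN; have w_prim := expi_prim_root N_gt0; set w := expi _ in w_prim *.
have q_gt0 : (0 < q)%N by apply: dvdn_gt0 qN.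
rewrite -(@sum_coprime_freqs _ N q (fun a => w ^+ (a * n))) //; last first.
  by rewrite mul0n exprM (prim_expr_order w_prim) expr1n.
apply: eq_bigr => k _; rewrite /w -expiMn; congr expi.
rewrite -[_ *+ _ in RHS]mulr_natr -[n%:~R]/(n%:R) !natrM.
have -> : N%:R = (N %/ q)%:R * q%:R :> R by rewrite -natrM divnK.
have Nq0 : (N %/ q)%:R != 0 :> R by rewrite pnatr_eq0 -lt0n divn_gt0 // dvdn_leq.
have q0 : q%:R != 0 :> R by rewrite pnatr_eq0 -lt0n.
by field; rewrite q0 Nq0.
Qed.

Lemma shift_ramanujan_vec N q m n : (0 < N)%N -> (q %| N)%N ->
  shift m%:Z (ramanujan_vec R N q) 0 n
   = \sum_(a in freqs N q) expi (2 * pi / N%:R : R) ^- (a * m)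
       * expi (2 * pi / N%:R : R) ^+ (a * n).
Proof.
move=> N_gt0 qN; have w_prim := expi_prim_root N_gt0.
rewrite !mxE (ramanujan_sum_freqs _ N_gt0 qN); set w := expi _ in w_prim *.
have w0 : w != 0 by rewrite (prim_root_eq0 w_prim) -lt0n.
(* Clearing the inverse power turns the claim into a congruence of exponents modulo [N]. *)
apply: eq_bigr => a _; apply: (mulfI (expf_neq0 (a * m) w0)).
rewrite mulVKf ?expf_neq0 // -exprD; apply/eqP.
by rewrite (eq_prim_root_expr w_prim) addnC -mulnDr -modnMmr sub_mod_add modnMmr.
Qed.

Lemma Re_sum (I : Type) (r : seq I) (P : pred I) (F : I -> R[i]) :
  complex.Re (\sum_(j <- r | P j) F j) = \sum_(j <- r | P j) complex.Re (F j).
Proof. by apply: (big_morph (@complex.Re R)) => // -[a b] [c d]. Qed.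

(** Squared modulus of the Fourier coefficient of [x] at [a]; [y * y^*] is already real. *)
Definition fourier_energy N (x : 'rV[R[i]]_N) (a : 'I_N) : R :=
  let y := dotmx x (row a (fourier_mx N (expi (2 * pi / N%:R : R)))) in
  complex.Re (y * y^*).

Lemma sqnorm_proj_ramanujan_space N p q (x : 'rV[R[i]]_N) :
  (0 < N)%N -> (q %| N)%N ->
  {in freqs N q &, forall a b : 'I_N, (p * a = p * b %[mod N])%N -> a = b} ->
  sqnorm (x *m proj_ortho (ramanujan_space R N p q))
   = \sum_(a in freqs N q) fourier_energy x a.
Proof.
move=> N_gt0 qN p_inj; rewrite /sqnorm /ramanujan_space.
rewrite (dotmx_proj_freqs (expi_prim_root N_gt0) _ p_inj).
- exact: Re_sum.
(* There are exactly as many shifts as interpolation nodes. *)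
- by rewrite card_freqs.
- by move=> k n; rewrite mxE shift_ramanujan_vec.
Qed.

(** Both parts of the theorem reduce to this: multiplication by [p] must be injective modulo [N] on
    frequencies of equal order. *)
Lemma parseval_ramanujan N p K (q : K.-tuple nat) :
  (0 < N)%N -> perm_eq q (divisors N) ->
  (forall r,
    {in freqs N r &, forall a b : 'I_N, (p * a = p * b %[mod N])%N -> a = b}) ->
  parseval_fusion_frame
    (fun i : 'I_K => ramanujan_space R N p (tnth q i)) (fun=> 1).
Proof.
move=> N_gt0 qN p_inj; split=> [i||x]; rewrite ?ltr01 ?lexx //.
suff -> : \sum_i 1 ^+ 2
      * sqnorm (x *m proj_ortho (ramanujan_space R N p (tnth q i))) = sqnorm x by rewrite mul1r lexx.
have w_prim := expi_prim_root N_gt0.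
rewrite {2}/sqnorm (dotmx_sum_row_unitary _ (fourier_unitary w_prim)).
rewrite Re_sum.
rewrite -[RHS]/(\sum_a fourier_energy x a).
transitivity (\sum_(r <- q) \sum_(a in freqs N r) fourier_energy x a).
  rewrite big_tuple; apply: eq_bigr => i _; rewrite expr1n mul1r.
  apply: sqnorm_proj_ramanujan_space => //.
  by rewrite dvdn_divisors // -(perm_mem qN) mem_tnth.
rewrite (perm_big _ qN) /=.
under eq_bigr do rewrite big_mkcond.
(* Each frequency [a] is counted once, at the divisor [r] equal to its order. *)
rewrite exchange_big /=; apply: eq_bigr => a _.
under eq_bigr do rewrite inE.
have Na : (N %/ gcdn a N)%N \in divisors N.
  by rewrite -dvdn_divisors // dvdn_div // dvdn_gcdr.
rewrite (bigD1_seq _ Na) ?divisors_uniq //= eqxx big1 ?addr0 // => r.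
by rewrite eq_sym => /negbTE ->.
Qed.

End Ramanujan.

Theorem theorem2p30 (R : realType) (N : nat) (hN : (0 < N)%N)
    (K : nat) (q : K.-tuple nat) (hq : perm_eq q (divisors N)) :
  parseval_fusion_frame
    (fun i : 'I_K => ramanujan_space R N 1 (tnth q i)) (fun=> 1)
  /\
  (forall d : nat, odd d -> N = (2 * d)%N ->
   parseval_fusion_frame
     (fun i : 'I_K => ramanujan_space R N 2 (tnth q i)) (fun=> 1)).
Proof.
split=> [|d d_odd NE]; apply: parseval_ramanujan => // r; last first.
  exact: (freqs_doubling_inj d_odd NE).
by move=> a b _ _; rewrite !mul1n !modn_small // => /val_inj.
Qed.
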